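(* Let $L>0$, $\mu\in(0,L)$, $\gamma L\in(0,2)$ and let $N$ be a positive integer. Then there exist $x_0$ and $f\in\mathcal{F}_{\mu,L}$ such that after applying $N$ iterations of gradient descent $x_{i+1}=x_i-\gamma\nabla f(x_i)$, $i=0,\dots,N-1$, on the function $f$ with constant stepsize $\gamma$ (normalized stepsize $\gamma L\in(0,2)$), starting from $x_0$, it holds $$\frac1{2L}\|\nabla f(x_N)\|^2=\frac{f(x_0)-f_*}{1+\gamma L\,\min\Big\{\frac{-1+(1-\gamma\mu)^{-2N}}{\gamma\mu},\ \frac{-1+(1-\gamma L)^{-2N}}{\gamma L}\Big\}}.$$
   Context: For $L\in(0,\infty)$ and $\mu\in(-\infty,L)$, $\mathcal{F}_{\mu,L}$ is the class of functions $f:\mathbb{R}^d\to\mathbb{R}$ such that both $\frac{L}{2}\|\cdot\|^2-f$ and $f-\frac{\mu}{2}\|\cdot\|^2$ are convex ($\|\cdot\|$ is the Euclidean norm; such functions are differentiable). Further, $f_*:=\inf_x f(x)$. When $1-\gamma L=0$ or $1-\gamma\mu=0$, the corresponding power $0^{-2N}$ is read as $+\infty$. *)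

(* Defs.v *)
From HB Require Import structures.
From mathcomp Require Import all_boot all_order all_algebra.
From mathcomp Require Import all_classical all_reals all_analysis.
Set Implicit Arguments.
Unset Strict Implicit.
Unset Printing Implicit Defensive.
Import Order.TTheory GRing.Theory Num.Theory.
Import numFieldNormedType.Exports.
Local Open Scope classical_set_scope.
Local Open Scope ring_scope.

(* The norm `|x| that the library puts on 'rV[R]_d is the sup norm, so the
   Euclidean norm is defined separately. *)
Definition enorm (R : realType) (d : nat) (x : 'rV[R]_d) : R :=
  Num.sqrt (\sum_(i < d) x 0 i ^+ 2).

(* f is not assumed differentiable: membership in the class implies it. *)
Definition smooth_class (R : realType) (d : nat) (mu L : R)
    (f : 'rV[R]_d -> R) : Prop :=
  convex_function setT (fun x : 'rV[R]_d => L / 2 * enorm x ^+ 2 - f x) /\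
  convex_function setT (fun x : 'rV[R]_d => f x - mu / 2 * enorm x ^+ 2).

(* 'D_v f x is a total operator, only meaningful where the derivative exists;
   functions in smooth_class mu L are differentiable everywhere. *)
Definition grad (R : realType) (d : nat) (f : 'rV[R]_d -> R) (x : 'rV[R]_d) :
    'rV[R]_d :=
  \row_(i < d) 'D_('e_i) f x.

Definition finf (R : realType) (d : nat) (f : 'rV[R]_d -> R) : \bar R :=
  ereal_inf (range (fun x => (f x)%:E)).

Definition gd_iter (R : realType) (d : nat) (gamma : R) (f : 'rV[R]_d -> R)
    (x0 : 'rV[R]_d) (i : nat) : 'rV[R]_d :=
  iter i (fun x => x - gamma *: grad f x) x0.

(* (-1 + (1 - gamma k)^(-2N)) / (gamma k).  Inversion is taken in \bar R,
   where 0^-1 = +oo: the value is +oo when 1 - gamma k = 0. *)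
Definition rate_term (R : realType) (gamma k : R) (N : nat) : \bar R :=
  ((-1 + ((1 - gamma * k) ^+ (2 * N))%:E^-1) / (gamma * k)%:E)%E.

(* Main.v *)
Require Import Defs.
From HB Require Import structures.
From mathcomp Require Import all_boot all_order all_algebra.
From mathcomp Require Import all_classical all_reals all_analysis.
From mathcomp Require Import ring lra.
Set Implicit Arguments.
Unset Strict Implicit.
Unset Printing Implicit Defensive.
Import Order.TTheory GRing.Theory Num.Theory.
Import numFieldNormedType.Exports.
Local Open Scope classical_set_scope.
Local Open Scope ring_scope.

(** Two functions compete for the worst case.  On the parabola of curvature [L],
    gradient descent multiplies the iterate by [1 - gamma * L], so the squared
    gradient decays by exactly [(1 - gamma * L) ^+ (2 * N)]: this is the term of
    the minimum in [L].  On a function with curvature [mu] far from its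
    minimizer and [L] near it, a start chosen so that the [N]-th iterate lands
    exactly on the kink between the two regimes keeps the orbit in the region of
    curvature [mu]; the gap [f x0 - f_*] can then be computed in closed form and
    gives the term in [mu].

    A single function realizes both:
      [f x = mu / 2 * |x|^2 + (L - mu) * huber (x 0 i)],
    with [huber] quadratic for arguments at most [1] and affine beyond.  Only the
    starting point on the [i]-th axis depends on which term is the minimum: the
    kink itself for the term in [L], a point beyond the kink for the term in
    [mu].  The two orbits are computed in [iter_profile_step_quadratic] and
    [iter_profile_step_affine], and [rate_min_cases] shows that the orbit needed
    is always available: the term in [mu] is the minimum only when
    [gamma * mu < 1], which keeps the second orbit monotone.

    Convexity and differentiability of [f] both come from one inequality
    ([extremal_sandwich]): the error of the linearization of [f] at [x] lies
    between [mu / 2 * |y - x|^2] and [L / 2 * |y - x|^2].  The bounds give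
    subgradients for the two functions that have to be convex
    ([sandwich_smooth_class]), the gradient ([sandwich_grad]), and the infimum
    ([sandwich_finf]). *)

(** * Inner products and quadratic sandwiches *)

Definition dot (R : realType) (d : nat) (x y : 'rV[R]_d) : R :=
  \sum_(i < d) x 0 i * y 0 i.

Lemma dotC (R : realType) (d : nat) (x y : 'rV[R]_d) : dot x y = dot y x.
Proof. by apply: eq_bigr => i _; rewrite mulrC. Qed.

Lemma dotDr (R : realType) (d : nat) (s x y : 'rV[R]_d) :
  dot s (x + y) = dot s x + dot s y.
Proof. by rewrite -big_split; apply: eq_bigr => i _; rewrite mxE mulrDr. Qed.

Lemma dotZr (R : realType) (d : nat) (a : R) (s x : 'rV[R]_d) :
  dot s (a *: x) = a * dot s x.
Proof. by rewrite /dot mulr_sumr; apply: eq_bigr => i _; rewrite mxE mulrCA. Qed.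

Lemma dotDl (R : realType) (d : nat) (s x y : 'rV[R]_d) :
  dot (x + y) s = dot x s + dot y s.
Proof. by rewrite !(dotC _ s) dotDr. Qed.

Lemma dotZl (R : realType) (d : nat) (a : R) (s x : 'rV[R]_d) :
  dot (a *: x) s = a * dot x s.
Proof. by rewrite !(dotC _ s) dotZr. Qed.

Lemma dotBr (R : realType) (d : nat) (s x y : 'rV[R]_d) :
  dot s (x - y) = dot s x - dot s y.
Proof. by rewrite dotDr -scaleN1r dotZr mulN1r. Qed.

Lemma dotBl (R : realType) (d : nat) (s x y : 'rV[R]_d) :
  dot (x - y) s = dot x s - dot y s.
Proof. by rewrite !(dotC _ s) dotBr. Qed.

Lemma dot_delta (R : realType) (d : nat) (i : 'I_d) (x : 'rV[R]_d) :
  dot (delta_mx 0 i) x = x 0 i.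
Proof.
rewrite /dot (bigD1 i)//= big1 => [|j ji]; rewrite !mxE ?eqxx ?mul1r ?addr0//.
by rewrite (negPf ji) mul0r.
Qed.

Lemma dot_ge0 (R : realType) (d : nat) (x : 'rV[R]_d) : 0 <= dot x x.
Proof. by apply: sumr_ge0 => i _; rewrite -expr2 sqr_ge0. Qed.

Lemma enorm_sqr (R : realType) (d : nat) (x : 'rV[R]_d) :
  enorm x ^+ 2 = dot x x.
Proof.
rewrite /enorm sqr_sqrtr; last by apply: sumr_ge0 => i _; rewrite sqr_ge0.
by apply: eq_bigr => i _; rewrite expr2.
Qed.

(** A supporting affine function at the barycenter of [x] and [y] agrees with
    the average of its values at [x] and [y], whence Jensen's inequality. *)
Lemma convex_of_subgradient (R : realType) (d : nat) (h : 'rV[R]_d -> R)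
    (s : 'rV[R]_d -> 'rV[R]_d) :
  (forall z y, h z + dot (s z) (y - z) <= h y) ->
  convex_function setT h.
Proof.
move=> hs t x y _ _; set z := conv t x y.
have t0 : 0 <= t%:inum by [].
have t1 : t%:inum <= 1 by [].
have zE : z = t%:inum *: x + (1 - t%:inum) *: y by [].
suff : h z <= t%:inum * h x + (1 - t%:inum) * h y by [].
have := ler_wpM2l t0 (hs z x).
have t1' : 0 <= 1 - t%:inum by rewrite subr_ge0.
have := ler_wpM2l t1' (hs z y).
rewrite !dotBr.
have -> : dot (s z) z =
    t%:inum * dot (s z) x + (1 - t%:inum) * dot (s z) y.
  by rewrite {2}zE dotDr !dotZr.
move: (dot _ x) (dot _ y) (h x) (h y) (h z) (t%:inum) => a b u v w r.
lra.
Qed.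

(** The difference quotient is within [C * `|h|] of [l]. *)
Lemma derive_of_quadratic_remainder (R : realType) (V : normedModType R)
    (F : V -> R) (a v : V) (l C : R) :
  (forall h, `|F (h *: v + a) - F a - h * l| <= C * h ^+ 2) ->
  'D_v F a = l.
Proof.
move=> hF; apply/cvg_lim => //; apply/cvgrPdist_le => e e0; near=> h.
have h0 : h != 0 by near: h; exact: nbhs_dnbhs_neq.
have he : `|h| <= e / (`|C| + 1).
  by near: h; apply: dnbhs0_le; rewrite divr_gt0// ltr_wpDl.
rewrite /= distrC.
have -> : h^-1 *: (F (h *: v + a) - F a) - l =
    h^-1 * (F (h *: v + a) - F a - h * l).
  by rewrite [in RHS]mulrBr mulKf.
rewrite normrM normfV ler_pdivrMl ?normr_gt0//.
apply: (le_trans (hF h)); rewrite -real_normK ?num_real// expr2 mulrCA.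
rewrite ler_wpM2l//.
apply: (@le_trans _ _ ((`|C| + 1) * `|h|)).
  by rewrite ler_wpM2r//; have := ler_norm C; lra.
by rewrite mulrC -ler_pdivlMr// ltr_wpDl.
Unshelve. all: by end_near. Qed.

(** [G] is meant to be the gradient of [f]; this first-order form is equivalent
    to membership in the smooth class, and it is easier to check because it
    is additive in [f]. *)
Definition quadratic_sandwich (R : realType) (d : nat) (mu L : R)
    (f : 'rV[R]_d -> R) (G : 'rV[R]_d -> 'rV[R]_d) : Prop :=
  forall x y, mu / 2 * dot (y - x) (y - x) <= f y - f x - dot (G x) (y - x)
                <= L / 2 * dot (y - x) (y - x).

(** Subtracting a parabola from [f] shifts the sandwich, so each of its two
    bounds says that [L *: z - G z], respectively [G z - mu *: z], is a
    subgradient at [z] of the function whose convexity is sought. *)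
Lemma sandwich_smooth_class (R : realType) (d : nat) (mu L : R)
    (f : 'rV[R]_d -> R) (G : 'rV[R]_d -> 'rV[R]_d) :
  quadratic_sandwich mu L f G -> smooth_class mu L f.
Proof.
move=> fG; split.
- apply: (@convex_of_subgradient _ _ _ (fun z => L *: z - G z)) => z y.
  have /andP[_] := fG z y.
  rewrite !enorm_sqr !dotBl !dotBr !dotZl (dotC y z).
  move: (dot y y) (dot z y) (dot z z) (dot _ y) (dot _ z) => a b c u v; lra.
- apply: (@convex_of_subgradient _ _ _ (fun z => G z - mu *: z)) => z y.
  have /andP[+ _] := fG z y.
  rewrite !enorm_sqr !dotBl !dotBr !dotZl (dotC y z).
  move: (dot y y) (dot z y) (dot z z) (dot _ y) (dot _ z) => a b c u v; lra.
Qed.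

Lemma sandwich_grad (R : realType) (d : nat) (mu L : R)
    (f : 'rV[R]_d -> R) (G : 'rV[R]_d -> 'rV[R]_d) (x : 'rV[R]_d) :
  quadratic_sandwich mu L f G -> grad f x = G x.
Proof.
move=> fG; apply/rowP => i; rewrite mxE.
apply: (@derive_of_quadratic_remainder _ _ _ _ _ _ (`|L / 2| + `|mu / 2|)) => h.
have := fG x (h *: 'e_i + x).
rewrite addrK !dotZl !dotZr dot_delta mxE !eqxx mulr1 (dotC (G x)) dot_delta.
move: (_ - _ - _) => r; rewrite -expr2 => /andP[lo hi].
have h2 := sqr_ge0 h.
have L2 := ler_wpM2r h2 (ler_norm (L / 2)).
have := ler_wpM2r h2 (ler_norm (- (mu / 2))); rewrite normrN => M2.
have L0 := mulr_ge0 (normr_ge0 (L / 2)) h2.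
have M0 := mulr_ge0 (normr_ge0 (mu / 2)) h2.
rewrite ler_norml mulrDl; lra.
Qed.

Lemma sandwich_finf (R : realType) (d : nat) (mu L : R)
    (f : 'rV[R]_d -> R) (G : 'rV[R]_d -> 'rV[R]_d) (z : 'rV[R]_d) :
  0 <= mu -> quadratic_sandwich mu L f G -> G z = 0 -> finf f = (f z)%:E.
Proof.
move=> mu0 fG Gz; apply/eqP; rewrite eq_le; apply/andP; split.
  by apply: ereal_inf_lbound; exists z.
apply: le_ereal_inf_tmp => _ [y _ <-]; rewrite lee_fin.
have /andP[+ _] := fG z y.
rewrite Gz -(scale0r (0 : 'rV[R]_d)) dotZl mul0r subr0 => H.
have : 0 <= mu / 2 * dot (y - z) (y - z) by rewrite mulr_ge0 ?dot_ge0// divr_ge0.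
lra.
Qed.

(** * The extremal function *)

(** A one-sided Huber function: it is quadratic on the whole of [t <= 1], so
    that orbits which alternate in sign around [0] see a pure parabola. *)
Definition huber (R : realType) (t : R) : R :=
  if t <= 1 then t ^+ 2 / 2 else t - 1 / 2.

Lemma huber_affine (R : realType) (t : R) : 1 <= t -> huber t = t - 1 / 2.
Proof.
by rewrite /huber le_eqVlt => /predU1P[<-|/lt_geF->//]; rewrite lexx; field.
Qed.

(** [Num.min s 1] is the derivative of the Huber function at [s], and it is
    nondecreasing and 1-Lipschitz. *)
Lemma huber_sandwich (R : realType) (s t : R) :
  0 <= huber t - huber s - Num.min s 1 * (t - s) <= (t - s) ^+ 2 / 2.
Proof.
rewrite /huber; case: (lerP t 1) => t1; case: (lerP s 1) => s1.
all: have s2 := sqr_ge0 (1 - s); have t2 := sqr_ge0 (1 - t).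
all: have st2 := sqr_ge0 (t - s).
- by apply/andP; split; lra.
- have := mulr_ge0 (ltac:(lra) : 0 <= s - 1) (ltac:(lra) : 0 <= 1 - t).
  by move=> st; apply/andP; split; lra.
- have := mulr_ge0 (ltac:(lra) : 0 <= 1 - s) (ltac:(lra) : 0 <= t - 1).
  by move=> st; apply/andP; split; lra.
- by apply/andP; split; lra.
Qed.

(** The restriction of the extremal function to the axis that carries the
    orbit: curvature [L] below [1] and [mu] above. *)
Definition profile (R : realType) (mu L t : R) : R :=
  mu / 2 * t ^+ 2 + (L - mu) * huber t.

Definition profile_slope (R : realType) (mu L t : R) : R :=
  mu * t + (L - mu) * Num.min t 1.

Definition extremal (R : realType) (d : nat) (mu L : R) (i : 'I_d)
    (x : 'rV[R]_d) : R :=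
  mu / 2 * dot x x + (L - mu) * huber (x 0 i).

Definition extremal_grad (R : realType) (d : nat) (mu L : R) (i : 'I_d)
    (x : 'rV[R]_d) : 'rV[R]_d :=
  mu *: x + ((L - mu) * Num.min (x 0 i) 1) *: 'e_i.

Lemma extremal_sandwich (R : realType) (d : nat) (mu L : R) (i : 'I_d) :
  mu <= L -> quadratic_sandwich mu L (extremal mu L i) (extremal_grad mu L i).
Proof.
move=> muL x y.
have Lmu : 0 <= L - mu by rewrite subr_ge0.
have /andP[lo hi] := huber_sandwich (x 0 i) (y 0 i).
have sq : (y 0 i - x 0 i) ^+ 2 <= dot (y - x) (y - x).
  rewrite /dot (bigD1 i)//= !mxE -expr2 lerDl.
  by apply: sumr_ge0 => j _; rewrite -expr2 sqr_ge0.
have {}lo := mulr_ge0 Lmu lo.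
have {hi}hi := ler_wpM2l Lmu (le_trans hi (ler_wpM2r (ltac:(lra) : 0 <= 2^-1) sq)).
move: lo hi.
rewrite /extremal /extremal_grad !dotBr !dotBl !dotDl !dotZl !dot_delta (dotC y x).
set c := Num.min _ _.
move: (dot y y) (dot x y) (dot x x) (x 0 i) (y 0 i) c (huber _) (huber _).
move=> a b e p q c u v; rewrite !mulrBr => lo hi; apply/andP; split; lra.
Qed.

Lemma extremal_axis (R : realType) (d : nat) (mu L a : R) (i : 'I_d) :
  extremal mu L i (a *: 'e_i) = profile mu L a.
Proof.
by rewrite /extremal dotZl dotZr dot_delta !mxE !eqxx !mulr1 -expr2.
Qed.

Lemma extremal_grad_axis (R : realType) (d : nat) (mu L a : R) (i : 'I_d) :
  extremal_grad mu L i (a *: 'e_i) = profile_slope mu L a *: 'e_i.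
Proof.
by rewrite /extremal_grad !mxE !eqxx !mulr1 scalerA -scalerDl.
Qed.

Definition profile_step (R : realType) (mu L gamma t : R) : R :=
  t - gamma * profile_slope mu L t.

Lemma gd_iter_axis (R : realType) (d : nat) (mu L gamma a : R) (i : 'I_d)
    (n : nat) : mu <= L ->
  gd_iter gamma (extremal mu L i) (a *: 'e_i) n =
    iter n (profile_step mu L gamma) a *: 'e_i.
Proof.
move=> muL; elim: n => [//|n IH]; rewrite /gd_iter !iterS -/(gd_iter _ _ _ n) IH.
rewrite (sandwich_grad _ (extremal_sandwich i muL)) extremal_grad_axis.
by rewrite scalerA -scalerBl.
Qed.

(** * Gradient orbits of the profile *)

Lemma min_contraction_expr (R : realType) (r : R) (n : nat) :
  -1 <= r <= 1 -> Num.min (r ^+ n) 1 = r ^+ n.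
Proof.
move=> r1; apply/min_idPl; apply: (le_trans (ler_norm _)).
by rewrite normrX exprn_ile1// ler_norml.
Qed.

(** From [1] the orbit never leaves the region [t <= 1], where the profile is
    the parabola [L / 2 * t ^+ 2]; this also covers [gamma * L > 1], where the
    iterates alternate in sign. *)
Lemma iter_profile_step_quadratic (R : realType) (mu L gamma : R) (n : nat) :
  0 <= gamma * L <= 2 ->
  iter n (profile_step mu L gamma) 1 = (1 - gamma * L) ^+ n.
Proof.
move=> /andP[g0 g2]; elim: n => [//|n IH].
rewrite iterS IH /profile_step /profile_slope.
rewrite min_contraction_expr; last lra.
by rewrite exprS; ring.
Qed.

(** For [t >= 1] the step is affine, contracting with ratio [1 - gamma * mu]
    about [1 - L / mu], the minimizer of the outer parabola.  The starting
    point is obtained by running that affine map backwards [n] times from [1];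
    since [0 < 1 - gamma * mu <= 1], going backwards moves away from
    the fixed point, which is at most [0], so all the points met are at least
    [1] and the affine formula is legitimate all along. *)
Lemma iter_profile_step_affine (R : realType) (mu L gamma : R) (n : nat) :
  0 < mu <= L -> 0 <= gamma * mu < 1 ->
  iter n (profile_step mu L gamma)
    (1 - L / mu + L / mu * (1 - gamma * mu) ^- n) = 1.
Proof.
move=> /andP[mu0 muL] /andP[g0 g1].
have r0 : 0 < 1 - gamma * mu by lra.
elim: n => [|n IH]; first by rewrite expr0 invr1 mulr1 subrK.
rewrite iterSr -[RHS]IH; congr (iter _ _ _).
have q1 : 1 <= (1 - gamma * mu) ^- n.+1.
  by rewrite invf_ge1 ?exprn_gt0// exprn_ile1//; lra.
have -> : (1 - gamma * mu) ^- n = (1 - gamma * mu) * (1 - gamma * mu) ^- n.+1.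
  by rewrite exprS invfM mulVKf// gt_eqF.
move: (_ ^- _) q1 => q q1; rewrite /profile_step /profile_slope.
have -> : Num.min (1 - L / mu + L / mu * q) 1 = 1.
  apply/min_idPr; rewrite -addrA lerDl -[X in 0 <= X](_ : L / mu * (q - 1) = _).
    by rewrite mulr_ge0 ?subr_ge0// divr_ge0; lra.
  by rewrite mulrBr mulr1 addrC.
by field; rewrite gt_eqF.
Qed.

(** * Which term of the rate is the minimum *)

Definition rate (R : realType) (gamma k : R) (N : nat) : R :=
  (-1 + (1 - gamma * k) ^- (2 * N)) / (gamma * k).

Lemma rate_termE (R : realType) (gamma k : R) (N : nat) :
  1 - gamma * k != 0 -> gamma * k != 0 ->
  rate_term gamma k N = ((rate gamma k N)%:E)%E.
Proof.
move=> k1 k0; rewrite /rate_term !inver expf_eq0 (negPf k1) andbF (negPf k0).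
by [].
Qed.

Lemma rate_term_infty (R : realType) (gamma k : R) (N : nat) : (0 < N)%N ->
  1 - gamma * k = 0 -> rate_term gamma k N = +oo%E.
Proof.
move=> N0 k1; rewrite /rate_term k1 expr0n muln_eq0 (gtn_eqF N0)/=.
have -> : gamma * k = 1 by lra.
by rewrite inve0 inve1 mule1.
Qed.

(** When [1 < gamma * k] the factor [1 - gamma * k] is negative and its modulus
    grows with [k], so replacing [k] by a larger [l] lowers
    the numerator and raises the denominator; the numerator stays nonnegative as long as
    [gamma * l <= 2]. *)
Lemma rate_le (R : realType) (gamma k l : R) (N : nat) :
  1 < gamma * k -> gamma * k <= gamma * l -> gamma * l <= 2 ->
  rate gamma l N <= rate gamma k N.
Proof.
move=> k1 kl l2.
have r0 m : 1 < gamma * m -> 0 < (1 - gamma * m) ^+ 2.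
  by move=> m1; rewrite exprn_even_gt0//= lt_eqF//; lra.
have k0 := r0 _ k1; have l0 := r0 _ (lt_le_trans k1 kl).
have le_kl : (1 - gamma * k) ^+ 2 <= (1 - gamma * l) ^+ 2.
  by move: (gamma * k) (gamma * l) k1 kl => u v u1 uv; nra.
have l_le1 : (1 - gamma * l) ^+ 2 <= 1.
  by move: (gamma * l) (lt_le_trans k1 kl) l2 => u u1 u2; nra.
have kN0 := exprn_gt0 N k0; have lN0 := exprn_gt0 N l0.
rewrite /rate !exprM; apply: ler_pM.
- by rewrite addrC subr_ge0 invf_ge1// exprn_ile1// ltW.
- by rewrite invr_ge0; lra.
- rewrite lerD2l lef_pV2 ?posrE//.
  by rewrite lerXn2r// nnegrE ltW.
- by rewrite lef_pV2 ?posrE//; lra.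
Qed.

(** The term in [mu] can be the minimum only if [1 - gamma * mu] is positive,
    which the backward orbit of the affine regime requires; the term in [L] is
    infinite only if [gamma * L = 1], and then [gamma * mu < 1] and the term
    in [mu] is finite and minimal. *)
Lemma rate_min_cases (R : realType) (gamma mu L : R) (N : nat) : (0 < N)%N ->
  0 < gamma * mu < gamma * L -> gamma * L <= 2 ->
  (gamma * mu < 1 /\ mine (rate_term gamma mu N) (rate_term gamma L N) =
       ((rate gamma mu N)%:E)%E) \/
  (1 - gamma * L != 0 /\ mine (rate_term gamma mu N) (rate_term gamma L N) =
       ((rate gamma L N)%:E)%E).
Proof.
move=> N0 /andP[m0 mL] L2.
have [m1|m1] := ltP (gamma * mu) 1.
  have muE : rate_term gamma mu N = ((rate gamma mu N)%:E)%E.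
    by apply: rate_termE; [rewrite gt_eqF// subr_gt0|rewrite gt_eqF].
  have [L1|L1] := eqVneq (1 - gamma * L) 0.
    left; split => //; rewrite muE (rate_term_infty N0 L1).
    by apply/min_idPl; rewrite leey.
  rewrite muE rate_termE//; last by rewrite gt_eqF// (lt_trans m0).
  by rewrite /mine/= /Order.min; case: ifP => _; [left|right].
have L1 : 1 - gamma * L != 0 by rewrite lt_eqF//; lra.
have LE : rate_term gamma L N = ((rate gamma L N)%:E)%E.
  by apply: rate_termE => //; rewrite gt_eqF// (lt_trans m0).
right; split => //; rewrite LE; apply/min_idPr.
have [m1'|m1'] := eqVneq (1 - gamma * mu) 0.
  by rewrite (rate_term_infty N0 m1') leey.
rewrite (rate_termE _ m1') ?gt_eqF// lee_fin rate_le//; last exact: ltW.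
by rewrite lt_neqAle m1 andbT; apply: contraNN m1' => /eqP <-; rewrite subrr.
Qed.

(** Everything happens on one axis, and the infimum of the extremal function is
    [0], so the statement comes down to an identity between the values of the
    one-dimensional profile and its slope. *)
Lemma extremal_attains (R : realType) (d : nat) (i : 'I_d) (mu L gamma a r : R)
    (N : nat) :
  0 < mu < L -> a != 0 ->
  1 + gamma * L * r != 0 ->
  1 / (2 * L) *
      profile_slope mu L (iter N (profile_step mu L gamma) a) ^+ 2 *
    (1 + gamma * L * r) = profile mu L a ->
  let f := extremal mu L i in
  let x0 := a *: 'e_i in
  [/\ smooth_class mu L f,
      (finf f < (f x0)%:E)%E &
      ((1 / (2 * L) * enorm (grad f (gd_iter gamma f x0 N)) ^+ 2)%:E =
        ((f x0)%:E - finf f) / (1 + (gamma * L)%:E * r%:E))%E].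
Proof.
move=> /andP[mu0 /ltW muL] a0 den aE f x0.
have fG : quadratic_sandwich mu L f (extremal_grad mu L i).
  exact: extremal_sandwich.
have min00 : Num.min (0 : R) 1 = 0 by apply/min_idPl.
have f0 : finf f = 0%E.
  rewrite (sandwich_finf (z := 0) (ltW mu0) fG); last first.
    by rewrite /extremal_grad mxE min00 mulr0 !scale0r scaler0 addr0.
  by rewrite -(scale0r 'e_i) /f extremal_axis /profile /huber ler01 expr0n/=;
    congr EFin; ring.
have fx0 : f x0 = profile mu L a by rewrite /f extremal_axis.
split; first exact: sandwich_smooth_class fG.
  have /andP[+ _] := huber_sandwich 0 a.
  rewrite min00 mul0r subr0 {2}/huber ler01 expr0n/= mul0r subr0 => h0.
  rewrite f0 lte_fin fx0 /profile ltr_wpDr ?mulr_ge0 ?subr_ge0//.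
  by rewrite mulr_gt0 ?exprn_even_gt0// divr_gt0.
rewrite f0 sube0 fx0 gd_iter_axis// (sandwich_grad _ fG) extremal_grad_axis.
rewrite enorm_sqr dotZl dotZr dot_delta mxE !eqxx mulr1 -expr2.
by rewrite -EFinM -EFinD inver (negPf den) -EFinM -aE mulfK.
Qed.

(** * Exactness of the rate *)

Theorem proposition5p3 (R : realType) (d : nat) (hd : (0 < d)%N)
    (L mu gamma : R) (hL : 0 < L) (hmu : 0 < mu < L)
    (hgamma : 0 < gamma * L < 2) (N : nat) (hN : (0 < N)%N) :
  exists (x0 : 'rV[R]_d) (f : 'rV[R]_d -> R),
    [/\ smooth_class mu L f,
        (finf f < (f x0)%:E)%E &
        ((1 / (2 * L) * enorm (grad f (gd_iter gamma f x0 N)) ^+ 2)%:E =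
          ((f x0)%:E - finf f) /
            (1 + (gamma * L)%:E *
                   mine (rate_term gamma mu N) (rate_term gamma L N)))%E].
Proof.
have [gL0 gL2] := andP hgamma; have [mu0 muL] := andP hmu.
have gamma0 : 0 < gamma by rewrite -(pmulr_lgt0 _ hL).
have gmu0 : 0 < gamma * mu by rewrite mulr_gt0.
have gmuL : gamma * mu < gamma * L by rewrite ltr_pM2l.
have muN0 : mu != 0 by rewrite gt_eqF.
have LN0 : L != 0 by rewrite gt_eqF.
have gN0 : gamma != 0 by rewrite gt_eqF.
have gLN0 : gamma * L != 0 by rewrite gt_eqF.
have gm_bounds : 0 < gamma * mu < gamma * L by rewrite gmu0.
have [[gmu1 ->]|[gL1 ->]] := rate_min_cases hN gm_bounds (ltW gL2).
(* The orbit stays in the outer parabola and reaches the kink at step N. *)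
- have r0 : 0 < 1 - gamma * mu by rewrite subr_gt0.
  have Lmu0 : 0 <= L / mu by rewrite divr_ge0 ?ltW.
  pose q := (1 - gamma * mu) ^- N.
  have q1 : 1 <= q.
    by rewrite invf_ge1 ?exprn_gt0// exprn_ile1//; lra.
  have rE : 1 + gamma * L * rate gamma mu N = 1 + L / mu * (q ^+ 2 - 1).
    rewrite /rate mulnC exprM -exprVn -/q.
    by field; rewrite muN0 gN0.
  pose a := 1 - L / mu + L / mu * q.
  have a1 : 1 <= a.
    rewrite -[X in X <= _]addr0 /a -addrA lerD2l.
    rewrite [X in _ <= X](_ : _ = L / mu * (q - 1)); last by ring.
    by rewrite mulr_ge0// subr_ge0.
  have q2 : 0 <= L / mu * (q ^+ 2 - 1).
    by rewrite mulr_ge0// subr_ge0 exprn_ege1.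
  exists (a *: 'e_(Ordinal hd)), (extremal mu L (Ordinal hd)).
  apply: extremal_attains => //.
  + by rewrite gt_eqF//; lra.
  + by rewrite rE gt_eqF//; lra.
  rewrite iter_profile_step_affine; [|by rewrite mu0 ltW|by rewrite ltW].
  rewrite rE /profile_slope minxx !mulr1 subrKC /profile huber_affine//.
  by rewrite /a; field; rewrite muN0 LN0.
(* The orbit stays in the inner parabola. *)
- pose q := (1 - gamma * L) ^+ N.
  have qN0 : q != 0 by rewrite expf_neq0.
  have rE : 1 + gamma * L * rate gamma L N = q ^- 2.
    by rewrite /rate mulnC exprM -/q mulrC mulfVK// addrA subrr add0r.
  exists (1 *: 'e_(Ordinal hd)), (extremal mu L (Ordinal hd)).
  apply: extremal_attains => //.
    by rewrite rE invr_neq0// expf_neq0.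
  rewrite iter_profile_step_quadratic; last by rewrite !ltW.
  rewrite rE /profile_slope /profile /huber lexx.
  rewrite min_contraction_expr; last lra.
  rewrite -/q.
  by field; rewrite LN0 qN0.
Qed.
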